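(* The sextic hypersurfaces in $\mathbb{P}^5$ $$Y:\ F_6=P_6-P_{42}+2P_{222}-16P_{111111}=0\qquad\text{and}\qquad Y^\vee:\ F_6^\vee=P_6-P_{42}+2P_{222}+16P_{111111}=0$$ are projectively dual to each other.
   Context: We work over $\mathbb{C}$ with homogeneous coordinates $x_0,\dots,x_5$ on $\mathbb{P}^5$; the dual projective space is identified with $\mathbb{P}^5$ via the dual coordinates. $P_6=\sum_i x_i^6$, $P_{42}=\sum_{i\ne j}x_i^4x_j^2$ ($30$ terms), $P_{222}=\sum_{i<j<k}x_i^2x_j^2x_k^2$ ($20$ terms), $P_{111111}=x_0x_1x_2x_3x_4x_5$. *)

(* Defs.v *)
From HB Require Import structures.
From mathcomp Require Import all_boot all_order all_algebra.
From mathcomp Require Import classical_sets reals.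
From mathcomp Require Import complex.
From mathcomp Require Import mpoly.

Set Implicit Arguments.
Unset Strict Implicit.
Unset Printing Implicit Defensive.

Import GRing.Theory.

Local Open Scope ring_scope.
Local Open Scope classical_set_scope.

(* The points of P^n are the lines through the origin of K^(n+1). *)
Definition proj (K : fieldType) (n : nat) : Type :=
  {L : {vspace 'rV[K]_n.+1} | \dim L == 1%N}.

Definition line (K : fieldType) (n : nat) (p : proj K n) :
  {vspace 'rV[K]_n.+1} := sval p.

Section ProjectiveDuality.
Variables (K : fieldType) (n : nat).
Implicit Types (F G : {mpoly K[n.+1]}) (p q xi : proj K n) (Z S : set (proj K n)).

Definition vanishes_at G p : Prop :=
  forall v : 'rV[K]_n.+1, v \in line p -> G.@[v 0] = 0.

Definition hypersurface F : set (proj K n) := [set p | vanishes_at F p].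

Definition zariski_closed Z : Prop :=
  exists2 I : set {mpoly K[n.+1]},
    (forall G, I G -> exists d : nat, G \is d.-homog) &
    Z = [set p | forall G, I G -> vanishes_at G p].

Definition zariski_closure S : set (proj K n) := smallest zariski_closed S.

(* F is a homogeneous equation of the hypersurface; smoothness refers to the
   scheme F = 0 and is given by the Jacobian criterion. *)
Definition smooth_point F p : Prop :=
  hypersurface F p /\ exists i : 'I_n.+1, ~ vanishes_at F^`M(i) p.

Definition tangent_space F p : set (proj K n) :=
  [set q | forall v w : 'rV[K]_n.+1, v \in line p -> w \in line q ->
     \sum_(i < n.+1) (F^`M(i)).@[v 0] * w 0 i = 0].

(* The dual projective space is identified with P^n through the dual
   coordinates: the point xi is the hyperplane sum_i xi_i x_i = 0. *)
Definition hyperplane xi : set (proj K n) :=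
  [set q | forall a w : 'rV[K]_n.+1, a \in line xi -> w \in line q ->
     \sum_(i < n.+1) a 0 i * w 0 i = 0].

Definition dual_variety F : set (proj K n) :=
  zariski_closure
    [set xi | exists2 p, smooth_point F p & hyperplane xi = tangent_space F p].

End ProjectiveDuality.

Section Sextics.
Variable K : fieldType.

Definition P6 : {mpoly K[6]} := \sum_(i < 6) 'X_i ^+ 6.

Definition P42 : {mpoly K[6]} :=
  \sum_(i < 6) \sum_(j < 6 | i != j) 'X_i ^+ 4 * 'X_j ^+ 2.

Definition P222 : {mpoly K[6]} :=
  \sum_(i < 6) \sum_(j < 6 | (i < j)%N) \sum_(k < 6 | (j < k)%N)
     'X_i ^+ 2 * 'X_j ^+ 2 * 'X_k ^+ 2.

Definition P111111 : {mpoly K[6]} := \prod_(i < 6) 'X_i.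

Definition F6 : {mpoly K[6]} := P6 - P42 + 2%:R * P222 - 16%:R * P111111.

Definition F6dual : {mpoly K[6]} := P6 - P42 + 2%:R * P222 + 16%:R * P111111.

End Sextics.

(* Main.v *)
(* Write u_i = x_i^2 and let 1 + a t + b t^2 + c t^3 + ... be the square root of
   \prod_i (1 - u_i t).  Then P6 - P42 + 2 P222 = - 16 c, so that the two sextics
   are c + s x_0...x_5 = 0 with s = 1 and s = -1.  With T(u) = u^3 + a u^2 + b u + c
   the equation gives \prod_i (u - u_i) = T(u)^2 + alpha u^2 + beta u, and the
   gradient, divided by 16, has coordinates y_i = T(u_i) / x_i.  Hence
   y_i^2 = - (alpha u_i + beta): the Gauss map acts on the squares of the
   coordinates by an affine map, which carries T to the cubic of y up to a scalar.
   The product of the y_i, i.e. the sign s of the dual sextic, is computed by a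
   resultant, and the same formulas show that the two Gauss maps are inverse to
   each other where x_0...x_5, alpha and the y_i do not vanish.  This open locus
   is dense: on a line of values of (x_1, ..., x_5) ending at (1, 1, 1, 2, 3) the
   sextic is a monic family of polynomials in x_0, and at (1, 1, 1, 2, 3) all its
   roots lie in that locus. *)
Require Import Defs.
From mathcomp Require Import all_boot all_order all_algebra.
From mathcomp Require Import classical_sets reals.
From mathcomp Require Import complex.
From mathcomp Require Import mpoly ring.

Set Implicit Arguments.
Unset Strict Implicit.
Unset Printing Implicit Defensive.

Import Order.TTheory GRing.Theory Num.Theory.

Local Open Scope ring_scope.

(** * Sums over six indices, cubics and partial derivatives *)

(** With explicit ordinals the filter [P] computes, so that [ring] and [field] see an expression in
    six variables. *)
Lemma big6 (R : Type) (idx : R) (op : Monoid.law idx) (P : pred 'I_6)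
    (F : 'I_6 -> R) (G := fun i => if P i then F i else idx) :
  \big[op/idx]_(i < 6 | P i) F i =
  op (G (@Ordinal 6 0 isT)) (op (G (@Ordinal 6 1 isT))
    (op (G (@Ordinal 6 2 isT)) (op (G (@Ordinal 6 3 isT))
      (op (G (@Ordinal 6 4 isT)) (G (@Ordinal 6 5 isT)))))).
Proof.
rewrite big_mkcond !big_ord_recl big_ord0 Monoid.mulm1.
by do !congr (op _ _); congr G; apply: val_inj.
Qed.

(** [t2] is a root of the quotient of the cubic by [u - t1], and [t3] is read off from the sum of
    the roots. *)
Lemma cubic_split (K : closedFieldType) (a b c : K) :
  exists t1 t2 t3, [/\ a = - (t1 + t2 + t3),
    b = t1 * t2 + t1 * t3 + t2 * t3 & c = - (t1 * t2 * t3)].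
Proof.
have [t1 t1E] := @solve_monicpoly K 3 (nth 0 [:: - c; - b; - a]) isT.
have [t2 t2E] := @solve_monicpoly K 2
  (nth 0 [:: - (b + a * t1 + t1 ^+ 2); - (a + t1)]) isT.
exists t1, t2, (- (a + t1 + t2)).
move: t1E t2E; rewrite !big_ord_recl !big_ord0 /= => t1E t2E.
have bE : b = - (a * t1 + t1 ^+ 2 + (a + t1) * t2 + t2 ^+ 2).
  by rewrite t2E; ring.
split; [by ring | by rewrite bE; ring |].
have -> : c = - (t1 ^+ 3 + a * t1 ^+ 2 + b * t1) by rewrite t1E; ring.
by rewrite bE; ring.
Qed.

Lemma size_horner_step (R : nzRingType) (p : {poly R}) c n :
  (size p <= n)%N -> (size (p * 'X + c%:P)%R <= n.+1)%N.
Proof. by rewrite size_MXaddC; case: ifP. Qed.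

Lemma mderivXn (n : nat) (R : comNzRingType) (p : {mpoly R[n]}) k i :
  (p ^+ k)^`M(i) = k%:R * p^`M(i) * p ^+ k.-1.
Proof.
elim: k => [|k IH]; first by rewrite -mpolyC1 mderivC !mul0r.
rewrite exprS mderivM IH; case: k {IH} => [|k] /=; last rewrite exprS; ring.
Qed.

Lemma mderivXU (n : nat) (R : nzRingType) (i j : 'I_n) :
  ('X_j : {mpoly R[n]})^`M(i) = (i == j)%:R.
Proof.
rewrite mderivX mnm1E eq_sym; have [->|_] := eqVneq i j; last by rewrite scale0r.
by rewrite scale1r -[X in (X - _)%MM]add0m addmK mpolyX0.
Qed.

Lemma mderiv_prodX (n : nat) (R : comNzRingType) (i : 'I_n) :
  (\prod_j ('X_j : {mpoly R[n]}))^`M(i) = \prod_(j | j != i) 'X_j.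
Proof.
rewrite (bigD1 i) //= mderivM mderivXU eqxx mul1r.
rewrite [X in _ + _ * X](_ : _ = 0) ?mulr0 ?addr0 //.
apply: (big_ind (fun p : {mpoly R[n]} => p^`M(i) = 0)) => [|p q pE qE|j ne_ji].
- by rewrite -mpolyC1 mderivC.
- by rewrite mderivM pE qE mul0r mulr0 addr0.
- by rewrite mderivXU eq_sym (negPf ne_ji).
Qed.

(** * Density in a monic family of polynomials *)

Lemma infinite_roots (K : numDomainType) (p : {poly K}) :
  (forall a, p.[a] = 0) -> p = 0.
Proof.
move=> p0; apply: (@roots_geq_poly_eq0 _ p (map (fun k => k%:R) (iota 0 (size p)))).
- by apply/allP => a _; rewrite rootE p0.
- by rewrite map_inj_uniq ?iota_uniq // => j k /eqP; rewrite eqr_nat => /eqP.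
- by rewrite size_map size_iota.
Qed.

Lemma horner_mx_eigen (K : fieldType) n (A : 'M[K]_n.+1) (v : 'rV_n.+1) a p :
  v *m A = a *: v -> v *m horner_mx A p = p.[a] *: v.
Proof.
move=> vA; elim/poly_ind: p => [|p c IH].
  by rewrite rmorph0 horner0 mulmx0 scale0r.
rewrite rmorphD rmorphM /= horner_mx_X horner_mx_C -mulmxE mulmxDr mulmxA IH.
rewrite -scalemxAl vA mul_mx_scalar scalerA -scalerDl hornerMXaddC.
by [].
Qed.

(* A polynomial in X over K[s] is evaluated at the companion matrix A of f, so
   that det n(A) plays the role of the resultant of f and n. *)
Lemma monic_family_dense (K : numClosedFieldType) (f g h : {poly {poly K}})
    (ev := fun a => map_poly (horner_eval a)) :
    f \is monic ->
    (forall a b, (ev a f).[b] = 0 -> (ev a g).[b] * (ev a h).[b] = 0) ->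
    (exists a, forall b, (ev a f).[b] = 0 -> (ev a h).[b] != 0) ->
  forall a b, (ev a f).[b] = 0 -> (ev a g).[b] = 0.
Proof.
move=> f_monic gh0 [a1 h1] a b fab.
have [n [A fE]] : exists n (A : 'M[{poly K}]_n.+1), f = char_poly A.
  have := companionmxK f_monic; move: (companionmx f).
  case: (size f).-1 => [|n] A fE; last by exists n, A.
  (* In degree 0 the monic [f] is 1 and has no root [b]. *)
  move: fab; rewrite -fE /char_poly det_mx00 /ev rmorph1 hornerC => /eqP.
  by rewrite oner_eq0.
pose Aa a := map_mx (horner_eval a) A.
have evfE c : ev c f = char_poly (Aa c) by rewrite fE -map_char_poly.
have evM c p : map_mx (horner_eval c) (horner_mx A p) = horner_mx (Aa c) (ev c p).
  exact: map_horner_mx.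
(* Each specialised [f] is a product of n+1 linear factors, each dividing the specialised [g * h];
   so it divides the power, and Cayley-Hamilton applies. An entry vanishing at every [c] is the zero
   polynomial. *)
have gh_nilp : horner_mx A (g * h) ^+ n.+1 = 0.
  rewrite -rmorphXn /=; apply/matrixP => i j; rewrite mxE; apply: infinite_roots => c.
  have -> (M : 'M[{poly K}]_n.+1) : (M i j).[c] = map_mx (horner_eval c) M i j.
    by rewrite mxE.
  rewrite evM; suff /dvdpP[q ->] : ev c f %| ev c ((g * h) ^+ n.+1).
    by rewrite rmorphM /= evfE Cayley_Hamilton mulr0 mxE.
  have size_evf : size (ev c f) = n.+2 by rewrite evfE size_char_poly.
  rewrite /ev rmorphXn rmorphM /= -/(ev c f) -/(ev c g) -/(ev c h).
  have [r rE] := closed_field_poly_normal (ev c f).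
  move: rE; rewrite [lead_coef _](_ : _ = 1) ?scale1r => [rE|]; last first.
    by rewrite evfE; apply/monicP/char_poly_monic.
  have -> : n.+1 = size r.
    by apply: succn_inj; rewrite -size_evf rE size_prod_XsubC.
  have : all (root (ev c g * ev c h)) r.
    apply/allP => z zr; rewrite rootE hornerM gh0 //.
    by apply/eqP; rewrite -rootE rE root_prod_XsubC.
  rewrite rE; elim: r {rE} => [|z r IH] /=; first by rewrite big_nil dvd1p.
  case/andP=> z0 r0; rewrite big_cons exprS.
  by apply: dvdp_mul (IH r0); rewrite dvdp_XsubCl.
(* At [a1] a Bezout relation between the coprime [f] and [h] makes [h(A)] invertible. *)
have det_h : \det (horner_mx A h) != 0.
  apply/eqP => det0; have : coprimep (ev a1 f) (ev a1 h).
    by apply: Pdiv.ClosedField.root_coprimep => b' /eqP/h1.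
  case/Bezout_eq1_coprimepP => -[u v] /= /(congr1 (horner_mx (Aa a1))).
  rewrite rmorphD !rmorphM rmorph1 /= evfE Cayley_Hamilton mulr0 add0r -evM.
  move/(congr1 determinant)/eqP; rewrite -mulmxE det_mulmx det_map_mx det0.
  by rewrite rmorph0 mulr0 det1 eq_sym oner_eq0.
(* Multiplication by the adjugate replaces [h(A)^(n+1)] by its determinant, a nonzero element of the
   domain K[s]. *)
have g_nilp : horner_mx A g ^+ n.+1 = 0.
  move: gh_nilp; rewrite -!rmorphXn exprMn rmorphM /= =>
    /(congr1 (mulmx^~ (\adj (horner_mx A (h ^+ n.+1))))).
  rewrite -mulmxE -mulmxA mul_mx_adj mul0mx mul_mx_scalar => E.
  apply/matrixP => i j; have /eqP := congr1 (fun M : 'M_n.+1 => M i j) E.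
  rewrite !mxE mulf_eq0 => /orP[/idPn|/eqP] //=; case.
  elim: {E}(n.+1 in X in _ ^+ X) => [|k IH].
    by rewrite rmorph1 det1 oner_neq0.
  by rewrite exprS rmorphM -mulmxE det_mulmx mulf_neq0.
(* On an eigenvector for the root [b] the zero matrix [g(A)^(n+1)] acts as [g(b)^(n+1)]. *)
have : eigenvalue (Aa a) b by rewrite eigenvalue_root_char -evfE rootE fab.
case/eigenvalueP => v vA v0; apply/eqP.
have := horner_mx_eigen (ev a (g ^+ n.+1)) vA.
rewrite -evM rmorphXn /= g_nilp map_mx0 mulmx0 /ev rmorphXn horner_exp => /esym/eqP.
by rewrite scaler_eq0 (negPf v0) orbF expf_eq0 => /andP[].
Qed.

(** * Projective points, hyperplanes and tangent spaces through spanning vectors *)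

Section Projective.
Variables (K : fieldType) (n : nat).
Implicit Types (F G : {mpoly K[n.+1]}) (p q xi : proj K n) (v w a : 'rV[K]_n.+1).

Lemma dhomog_meval d F (c : K) (v : 'I_n.+1 -> K) : F \is d.-homog ->
  F.@[fun i => c * v i] = c ^+ d * F.@[v].
Proof.
move=> /dhomogP homF; rewrite !mevalE mulr_sumr !big_seq; apply: eq_bigr => m mF.
rewrite mulrCA; congr (_ * _); under eq_bigr do rewrite exprMn.
by rewrite big_split /= prodrXr -mdegE (homF _ mF).
Qed.

Lemma dhomog_mderiv d F i : F \is d.+1.-homog -> F^`M(i) \is d.-homog.
Proof.
move=> /dhomogP homF; rewrite /mderiv big_seq; apply: rpred_sum => m mF.
have [->|mi0] := eqVneq (m i) 0%N; first by rewrite mul0r scale0r rpred0.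
have Ui : (U_(i) <= m)%MM by rewrite lep1mP.
have degm : mdeg m = d.+1 := homF _ mF.
move: degm; rewrite -{1}(submK Ui) mdegD mdeg1 addn1 => -[degm].
by apply: rpredZ; rewrite dhomogX; apply/eqP.
Qed.

Lemma line_vline p : exists2 v, v != 0 & line p = <[v]>%VS.
Proof.
case: p => L dimL; have v0 : vpick L != 0 by rewrite vpick0 -dimv_eq0 (eqP dimL).
exists (vpick L) => //; apply/esym/eqP.
by rewrite eqEdim -memvE memv_pick dim_vline v0 (eqP dimL).
Qed.

Lemma vline_proj v : v != 0 -> exists p, line p = <[v]>%VS.
Proof.
move=> v0; have dimv : \dim <[v]> == 1%N by rewrite dim_vline v0.
by exists (exist _ <[v]>%VS dimv).
Qed.

Lemma vanishes_atE d G p v : G \is d.-homog -> line p = <[v]>%VS ->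
  vanishes_at G p <-> G.@[v 0] = 0.
Proof.
move=> homG pv; split=> [|Gv w]; first by apply; rewrite pv memv_line.
rewrite pv => /vlineP[c ->].
rewrite (meval_eq (v2 := fun i => c * v 0 i)) => [|i]; last by rewrite mxE.
by rewrite (dhomog_meval _ _ homG) Gv mulr0.
Qed.

Lemma hyperplaneE xi q a w : line xi = <[a]>%VS -> line q = <[w]>%VS ->
  hyperplane xi q <-> \sum_i a 0 i * w 0 i = 0.
Proof.
move=> xia qw; split=> [|aw0 a' w']; first by apply; rewrite ?xia ?qw memv_line.
rewrite xia qw => /vlineP[c ->] /vlineP[c' ->].
transitivity (c * c' * \sum_i a 0 i * w 0 i); last by rewrite aw0 mulr0.
by rewrite mulr_sumr; apply: eq_bigr => i _; rewrite !mxE mulrACA.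
Qed.

Lemma tangent_spaceE d F p q v w : F \is d.+1.-homog ->
    line p = <[v]>%VS -> line q = <[w]>%VS ->
  tangent_space F p q <-> \sum_i (F^`M(i)).@[v 0] * w 0 i = 0.
Proof.
move=> homF pv qw; split=> [|vw0 v' w']; first by apply; rewrite ?pv ?qw memv_line.
rewrite pv qw => /vlineP[c ->] /vlineP[c' ->].
transitivity (c ^+ d * c' * \sum_i (F^`M(i)).@[v 0] * w 0 i); last first.
  by rewrite vw0 mulr0.
rewrite mulr_sumr; apply: eq_bigr => i _.
rewrite (meval_eq (v2 := fun j => c * v 0 j)) => [|j]; last by rewrite mxE.
by rewrite (dhomog_meval _ _ (dhomog_mderiv i homF)) mxE mulrACA.
Qed.

Lemma zariski_closed_hypersurface d F :
  F \is d.-homog -> zariski_closed (hypersurface F).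
Proof.
move=> homF; exists [set F]%classic; first by move=> G ->; exists d.
by apply/seteqP; split=> p /= Fp; [move=> G -> | apply: Fp].
Qed.

(** The test vector [g_i e_j - g_j e_i] is a zero of the form [g], and it is nonzero because [g_i]
    is. *)
Lemma same_kernel_proportional (a g : 'rV[K]_n.+1) i : g 0 i != 0 ->
    (forall w, w != 0 ->
       \sum_j a 0 j * w 0 j = 0 <-> \sum_j g 0 j * w 0 j = 0) ->
  forall j, a 0 j = a 0 i / g 0 i * g 0 j.
Proof.
move=> gi0 same j; have [->|ij] := eqVneq j i; first by rewrite divfK.
have dotE (b : 'rV[K]_n.+1) :
    \sum_k b 0 k * (g 0 i *: 'e_j - g 0 j *: 'e_i : 'rV_n.+1) 0 k
    = g 0 i * b 0 j - g 0 j * b 0 i.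
  rewrite (bigD1 j) //= (bigD1 i) 1?eq_sym //= big1 ?addr0 => [|k /andP[kj ki]].
    by rewrite !mxE !eqxx /= (negPf ij) [i == j]eq_sym (negPf ij) /=; ring.
  by rewrite !mxE (negPf kj) (negPf ki) /=; ring.
have w0 : g 0 i *: 'e_j - g 0 j *: 'e_i != 0 :> 'rV_n.+1.
  apply/eqP => /rowP/(_ j); rewrite !mxE !eqxx /= (negPf ij) => /eqP.
  by rewrite mulr1 mulr0 subr0 (negPf gi0).
have [_] := same _ w0; rewrite !dotE => /(_ _)/eqP; rewrite subr_eq0 => aE.
apply: (mulfI gi0); rewrite (eqP (aE _)); last by rewrite mulrC subrr.
by field.
Qed.

End Projective.

(** * The truncated square root and the two sextics *)

Section Invariants.
Variable K : numClosedFieldType.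
Implicit Types (x y : 'I_6 -> K) (s u : K).

Definition psum (k : nat) : {mpoly K[6]} := \sum_(i < 6) 'X_i ^+ (k.*2).

(* [sqrt1, ..., sqrt5] are the coefficients of t, ..., t^5 in the power series
   sqrt (\prod_i (1 - x_i^2 t)) = exp (- \sum_k psum k t^k / (2 k)). *)
Definition sqrt1 := - 2^-1 *: psum 1.
Definition sqrt2 := - 4^-1 *: (psum 2 + psum 1 * sqrt1).
Definition sqrt3 := - 6^-1 *: (psum 3 + psum 2 * sqrt1 + psum 1 * sqrt2).
Definition sqrt4 :=
  - 8^-1 *: (psum 4 + psum 3 * sqrt1 + psum 2 * sqrt2 + psum 1 * sqrt3).
Definition sqrt5 :=
  - 10^-1 *: (psum 5 + psum 4 * sqrt1 + psum 3 * sqrt2 + psum 2 * sqrt3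
              + psum 1 * sqrt4).
(** The coefficients alpha and beta of u^2 and u in the product of the u - x_i^2 minus T(u)^2, read
    off from the square of T(u) + [sqrt4]/u + [sqrt5]/u^2 + ... *)
Definition slope := 2 *: sqrt4.
Definition offset := 2 *: (sqrt5 + sqrt1 * sqrt4).

Lemma psumE k x : (psum k).@[x] = \sum_(i < 6) x i ^+ (k.*2).
Proof.
rewrite /psum raddf_sum; apply: eq_bigr => i _.
by rewrite /= rmorphXn /= mevalXU.
Qed.

Lemma sqrt1E x : sqrt1.@[x] = - 2^-1 * (psum 1).@[x].
Proof. exact: mevalZ. Qed.

Lemma sqrt2E x :
  sqrt2.@[x] = - 4^-1 * ((psum 2).@[x] + (psum 1).@[x] * sqrt1.@[x]).
Proof. by rewrite mevalZ mevalD mevalM. Qed.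

Lemma sqrt3E x :
  sqrt3.@[x] = - 6^-1 * ((psum 3).@[x] + (psum 2).@[x] * sqrt1.@[x]
                         + (psum 1).@[x] * sqrt2.@[x]).
Proof. by rewrite mevalZ !mevalD !mevalM. Qed.

Lemma sqrt4E x :
  sqrt4.@[x] = - 8^-1 * ((psum 4).@[x] + (psum 3).@[x] * sqrt1.@[x]
    + (psum 2).@[x] * sqrt2.@[x] + (psum 1).@[x] * sqrt3.@[x]).
Proof. by rewrite mevalZ !mevalD !mevalM. Qed.

Lemma sqrt5E x :
  sqrt5.@[x] = - 10^-1 * ((psum 5).@[x] + (psum 4).@[x] * sqrt1.@[x]
    + (psum 3).@[x] * sqrt2.@[x] + (psum 2).@[x] * sqrt3.@[x]
    + (psum 1).@[x] * sqrt4.@[x]).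
Proof. by rewrite mevalZ !mevalD !mevalM. Qed.

Lemma slopeE x : slope.@[x] = 2 * sqrt4.@[x].
Proof. exact: mevalZ. Qed.

Lemma offsetE x :
  offset.@[x] = 2 * (sqrt5.@[x] + sqrt1.@[x] * sqrt4.@[x]).
Proof. by rewrite mevalZ mevalD mevalM. Qed.

Definition invE :=
  (slopeE, offsetE, sqrt5E, sqrt4E, sqrt3E, sqrt2E, sqrt1E).

Definition cubic x u :=
  u ^+ 3 + sqrt1.@[x] * u ^+ 2 + sqrt2.@[x] * u + sqrt3.@[x].

(** [cubic] is the polynomial part of the square root of the product at u = infinity, so the
    remainder has degree at most 2. Its constant term vanishes exactly on the union of the two
    sextics. *)
Lemma cubic_sqr x u :
  \prod_i (u - x i ^+ 2) =
  cubic x u ^+ 2 + slope.@[x] * u ^+ 2 + offset.@[x] * u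
  + ((\prod_i x i) ^+ 2 - sqrt3.@[x] ^+ 2).
Proof.
rewrite /cubic !invE.
have := (psumE 1 x, psumE 2 x, psumE 3 x, psumE 4 x, psumE 5 x).
rewrite !big6 /=.
move: (psum 1).@[x] (psum 2).@[x] (psum 3).@[x] (psum 4).@[x] (psum 5).@[x].
move=> p1 p2 p3 p4 p5 [[[[-> ->] ->] ->] ->].
move: (x _) (x _) (x _) (x _) (x _) (x _) => a b c d e f.
by rewrite -!mul2n !exprM; field.
Qed.

(** The sign [s] treats both sextics at once; duality exchanges [s] and [- s]. *)
Definition sextic s : {mpoly K[6]} :=
  P6 K - P42 K + 2%:R * P222 K - (16%:R * s) *: P111111 K.

Lemma F6_sextic : F6 K = sextic 1.
Proof. by rewrite /F6 /sextic mulr1 scaler_nat (mulr_natl _ 16). Qed.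

Lemma F6dual_sextic : F6dual K = sextic (- 1).
Proof.
by rewrite /F6dual /sextic mulrN1 scaleNr opprK scaler_nat (mulr_natl _ 16).
Qed.

(** Power sums connect the symmetric part with [sqrt3]; the factor 3 keeps the coefficients
    integral. *)
Lemma sextic_psum s :
  3%:R *: sextic s =
  psum 1 ^+ 3 - 6%:R * (psum 1 * psum 2) + 8%:R * psum 3
  - (48%:R * s) *: P111111 K.
Proof.
have -> : 48%:R * s = 3%:R * (16%:R * s) by ring.
rewrite /sextic scalerBr scalerA; congr (_ - _).
rewrite scaler_nat -[_ *+ 3]mulr_natl /P6 /P42 /P222 /psum.
rewrite !big6 /=.
ring.
Qed.

Lemma P111111E x : (P111111 K).@[x] = \prod_i x i.
Proof. by rewrite rmorph_prod; apply: eq_bigr => i _; rewrite /= mevalXU. Qed.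

Lemma mevalXn (p : {mpoly K[6]}) k x : (p ^+ k).@[x] = p.@[x] ^+ k.
Proof. exact: rmorphXn. Qed.

Lemma sexticE s x :
  (sextic s).@[x] = - 16%:R * (sqrt3.@[x] + s * \prod_i x i).
Proof.
have E : 3%:R * (sextic s).@[x] =
    (psum 1).@[x] ^+ 3 - 6%:R * ((psum 1).@[x] * (psum 2).@[x])
    + 8%:R * (psum 3).@[x] - 48%:R * s * \prod_i x i.
  rewrite -mevalZ sextic_psum mevalB mevalZ P111111E mevalD mevalB mevalXn.
  by rewrite (mevalM _ 6%:R) (mevalM _ 8%:R) mevalM !rmorph_nat.
apply: (@mulfI _ (3%:R : K)); first by rewrite pnatr_eq0.
by rewrite {}E sqrt3E sqrt2E sqrt1E; field.
Qed.

(** * The Gauss map of a sextic and its inverse *)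

Lemma mderiv_psum k i x :
  ((psum k)^`M(i)).@[x] = (k.*2)%:R * x i ^+ (k.*2.-1).
Proof.
rewrite /psum (raddf_sum (mderiv i)) (bigD1 i) //= big1 => [|j ne_ji].
  by rewrite addr0 mderivXn mderivXU eqxx mulr1 mevalM mevalXn rmorph_nat mevalXU.
by rewrite mderivXn mderivXU eq_sym (negPf ne_ji) mulr0 mul0r.
Qed.

(** The gradient divided by 16, in a polynomial form that makes sense where [x i] vanishes too. *)
Definition sextic_grad s x i :=
  x i ^+ 5 + sqrt1.@[x] * x i ^+ 3 + sqrt2.@[x] * x i
  - s * \prod_(j | j != i) x j.

Lemma mderiv_sextic s i x :
  ((sextic s)^`M(i)).@[x] = 16%:R * sextic_grad s x i.
Proof.
have E : 3%:R * ((sextic s)^`M(i)).@[x] =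
    3%:R * (psum 1).@[x] ^+ 2 * ((psum 1)^`M(i)).@[x]
    - 6%:R * (((psum 1)^`M(i)).@[x] * (psum 2).@[x]
              + (psum 1).@[x] * ((psum 2)^`M(i)).@[x])
    + 8%:R * ((psum 3)^`M(i)).@[x]
    - 48%:R * s * \prod_(j | j != i) x j.
  rewrite -mevalZ -mderivZ sextic_psum -!mpolyC_nat !mul_mpolyC.
  rewrite mderivB mderivD mderivB !mderivZ mderivXn (mderivM i (psum 1)).
  rewrite mevalB mevalD mevalB !mevalZ (mevalD _ (_ * _)).
  rewrite (mevalM _ (psum 1)^`M(i)) (mevalM _ (psum 1)) (mevalM _ (_ * _)).
  rewrite (mevalM _ 3%:R) mevalXn rmorph_nat.
  rewrite /P111111 mderiv_prodX rmorph_prod /=.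
  under [X in _ - _ * X]eq_bigr do rewrite mevalXU.
  ring.
apply: (@mulfI _ (3%:R : K)); first by rewrite pnatr_eq0.
by rewrite {}E !mderiv_psum -!mul2n /sextic_grad /= sqrt2E sqrt1E; field.
Qed.

Lemma sextic_root s x : (sextic s).@[x] = 0 -> sqrt3.@[x] = - s * \prod_i x i.
Proof.
rewrite sexticE => /eqP; rewrite mulf_eq0 oppr_eq0 pnatr_eq0 /= addr_eq0 mulNr.
by move/eqP.
Qed.

Lemma sextic_grad_mul s x i : (sextic s).@[x] = 0 ->
  x i * sextic_grad s x i = cubic x (x i ^+ 2).
Proof.
move/sextic_root; rewrite /cubic /sextic_grad (bigD1 i) //= => ->; ring.
Qed.

Lemma cubic_sqr_sextic s x u : s ^+ 2 = 1 -> (sextic s).@[x] = 0 ->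
  \prod_i (u - x i ^+ 2) =
  cubic x u ^+ 2 + slope.@[x] * u ^+ 2 + offset.@[x] * u.
Proof.
move=> s1 /sextic_root s3E; rewrite cubic_sqr s3E exprMn sqrrN s1 mul1r.
by rewrite subrr addr0.
Qed.

(** At u = x_i^2 the product vanishes, so T(u)^2 = - (alpha u^2 + beta u); the left side is x_i^2
    y_i^2, and x_i^2 cancels. *)
Lemma sextic_grad_sqr s x i :
    s ^+ 2 = 1 -> (sextic s).@[x] = 0 -> x i != 0 ->
  sextic_grad s x i ^+ 2 = - (slope.@[x] * x i ^+ 2 + offset.@[x]).
Proof.
move=> s1 Fx xi0; have := cubic_sqr_sextic (x i ^+ 2) s1 Fx.
rewrite (bigD1 i) //= subrr mul0r -(sextic_grad_mul i Fx) => E.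
apply: (mulfI (expf_neq0 2 xi0)); apply/eqP; rewrite -subr_eq0; apply/eqP.
rewrite {}[RHS]E.
move: (sextic_grad s x i) slope.@[x] offset.@[x] (x i) => y a b c.
ring.
Qed.

(* The resultant of the cubic and of [\prod_i (u - x_i^2)], computed in both
   orders. *)
Lemma prod_sextic_grad s x :
    s ^+ 2 = 1 -> (sextic s).@[x] = 0 -> \prod_i x i != 0 ->
  \prod_i sextic_grad s x i =
  s * (offset.@[x] ^+ 3 - offset.@[x] ^+ 2 * slope.@[x] * sqrt1.@[x]
       + offset.@[x] * slope.@[x] ^+ 2 * sqrt2.@[x]
       - slope.@[x] ^+ 3 * sqrt3.@[x]).
Proof.
(* Multiplying by the product of the x_i turns each factor y_i into T(x_i^2). *)
move=> s1 Fx e0; apply: (mulfI e0); rewrite -big_split /=.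
under eq_bigr do rewrite (sextic_grad_mul _ Fx).
have [t1 [t2 [t3 [aE bE cE]]]] := cubic_split sqrt1.@[x] sqrt2.@[x] sqrt3.@[x].
have cubicE u : cubic x u = (u - t1) * (u - t2) * (u - t3).
  by rewrite /cubic aE bE cE; ring.
(* At a root of T only alpha t^2 + beta t survives; the six sign changes cancel. *)
have prodE t : cubic x t = 0 ->
    \prod_i (x i ^+ 2 - t) = slope.@[x] * t ^+ 2 + offset.@[x] * t.
  move=> t0; transitivity (\prod_i (t - x i ^+ 2)).
    under [RHS]eq_bigr do rewrite -opprB.
    by rewrite prodrN cardT size_enum_ord -signr_odd mul1r.
  by rewrite (cubic_sqr_sextic t s1 Fx) t0 expr0n add0r.
under eq_bigr do rewrite cubicE.
rewrite !big_split /= !prodE ?cubicE ?subrr ?mulr0 ?mul0r //.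
have eE : \prod_i x i = s * (t1 * t2 * t3).
  have := sextic_root Fx; rewrite cE => /eqP; rewrite mulNr eqr_opp => /eqP ->.
  by rewrite mulrA -expr2 s1 mul1r.
rewrite eE aE bE cE -[LHS]mul1r -s1.
by move: slope.@[x] offset.@[x] => a b; ring.
Qed.

Section Dual.
Variables (s : K) (x y : 'I_6 -> K).
Hypothesis y_sqr :
  forall i, y i ^+ 2 = - (slope.@[x] * x i ^+ 2 + offset.@[x]).

Lemma psum_dual :
  [/\ (psum 1).@[y] = - (slope.@[x] * (psum 1).@[x] + 6%:R * offset.@[x]),
      (psum 2).@[y] = slope.@[x] ^+ 2 * (psum 2).@[x]
        + 2%:R * slope.@[x] * offset.@[x] * (psum 1).@[x]
        + 6%:R * offset.@[x] ^+ 2 &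
      (psum 3).@[y] = - (slope.@[x] ^+ 3 * (psum 3).@[x]
        + 3%:R * slope.@[x] ^+ 2 * offset.@[x] * (psum 2).@[x]
        + 3%:R * slope.@[x] * offset.@[x] ^+ 2 * (psum 1).@[x]
        + 6%:R * offset.@[x] ^+ 3)].
Proof.
have psum_y k : (psum k).@[y] =
    \sum_i (- (slope.@[x] * x i ^+ 2 + offset.@[x])) ^+ k.
  by rewrite psumE; apply: eq_bigr => i _; rewrite -mul2n exprM y_sqr.
rewrite !psum_y !psumE.
move: slope.@[x] offset.@[x] => a b.
by split; rewrite !big6 /=; ring.
Qed.

Lemma sqrt3_dual :
  sqrt3.@[y] =
    offset.@[x] ^+ 3 - offset.@[x] ^+ 2 * slope.@[x] * sqrt1.@[x]
    + offset.@[x] * slope.@[x] ^+ 2 * sqrt2.@[x] - slope.@[x] ^+ 3 * sqrt3.@[x].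
Proof.
rewrite !sqrt3E !sqrt2E !sqrt1E; have [-> -> ->] := psum_dual.
move: slope.@[x] offset.@[x] (psum 1).@[x] (psum 2).@[x] (psum 3).@[x].
by move=> a b p1 p2 p3; field.
Qed.

(** Taking the polynomial part of the square root commutes with affine changes of u; scaling by -
    alpha multiplies the cubic by (- alpha)^3. *)
Lemma cubic_dual u :
  cubic y (- (slope.@[x] * u + offset.@[x])) = - slope.@[x] ^+ 3 * cubic x u.
Proof.
rewrite /cubic !sqrt3E !sqrt2E !sqrt1E; have [-> -> ->] := psum_dual.
move: slope.@[x] offset.@[x] (psum 1).@[x] (psum 2).@[x] (psum 3).@[x].
by move=> a b p1 p2 p3; field.
Qed.

End Dual.

Lemma prod_neq0 x i : \prod_j x j != 0 -> x i != 0.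
Proof. by move/prodf_neq0; apply. Qed.

(** [sqrt3_dual] and [prod_sextic_grad] have the same right-hand side up to [s], which is the
    equation with sign [- s]. *)
Lemma sextic_dual s x :
    s ^+ 2 = 1 -> (sextic s).@[x] = 0 -> \prod_i x i != 0 ->
  (sextic (- s)).@[sextic_grad s x] = 0.
Proof.
move=> s1 Fx e0; have y_sqr i := sextic_grad_sqr s1 Fx (prod_neq0 i e0).
rewrite sexticE (sqrt3_dual y_sqr) prod_sextic_grad //.
by rewrite [- s * _]mulNr [s * (s * _)]mulrA -expr2 s1 mul1r subrr mulr0.
Qed.

(** After multiplication by y_i both sides are cubics: the one of y at y_i^2 and, up to - alpha^3,
    the one of x at x_i^2. *)
Lemma sextic_bidual s x i :
    s ^+ 2 = 1 -> (sextic s).@[x] = 0 -> \prod_j x j != 0 ->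
    sextic_grad s x i != 0 ->
  sextic_grad (- s) (sextic_grad s x) i = - slope.@[x] ^+ 3 * x i.
Proof.
move=> s1 Fx e0 y0; have y_sqr j := sextic_grad_sqr s1 Fx (prod_neq0 j e0).
apply: (mulfI y0); rewrite (sextic_grad_mul i (sextic_dual s1 Fx e0)).
rewrite y_sqr (cubic_dual y_sqr) -(sextic_grad_mul i Fx); ring.
Qed.

(** * The generic locus and a fibre contained in it *)

(* The image of the Gauss map is only controlled where [generic] does not
   vanish. *)
Definition generic : {mpoly K[6]} :=
  P111111 K * slope *
  \prod_i ('X_i ^+ 6 + sqrt1 * 'X_i ^+ 4 + sqrt2 * 'X_i ^+ 2 + sqrt3).

Lemma genericE x :
  generic.@[x] = (\prod_i x i) * slope.@[x] * \prod_i cubic x (x i ^+ 2).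
Proof.
rewrite /generic mevalM [in LHS]mevalM P111111E rmorph_prod /=; congr (_ * _).
apply: eq_bigr => i _; rewrite !mevalD [(sqrt1 * _).@[x]]mevalM.
by rewrite [(sqrt2 * _).@[x]]mevalM !mevalXn !mevalXU /cubic -!exprM.
Qed.

Lemma generic_neq0 s x : (sextic s).@[x] = 0 -> generic.@[x] != 0 ->
  [/\ \prod_i x i != 0, slope.@[x] != 0 & forall i, sextic_grad s x i != 0].
Proof.
move=> Fx; rewrite genericE !mulf_eq0 !negb_or => /andP[/andP[-> ->] /prodf_neq0 T0].
split=> // i; have := T0 i isT; rewrite -(sextic_grad_mul i Fx) mulf_eq0 negb_or.
by case/andP.
Qed.

(* At this point the resultants of the sextic, as a polynomial in x_0, with the
   factors of [generic] do not vanish; they are the constants in the Bezout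
   relations below, where u stands for x_0^2.  Numerals are unary, hence the
   base 1000. *)
Definition witness : seq nat := [:: 0; 1; 1; 1; 2; 3]%N.

Lemma witness_generic s x : s ^+ 2 = 1 ->
    (forall i, i != ord0 -> x i = (nth 0 witness i)%:R) ->
  (sextic s).@[x] = 0 -> generic.@[x] != 0.
Proof.
move=> s1 xE Fx.
have [x1 x2 x3 x4 x5] : [/\ x (@Ordinal 6 1 isT) = 1, x (@Ordinal 6 2 isT) = 1,
    x (@Ordinal 6 3 isT) = 1, x (@Ordinal 6 4 isT) = 2%:R &
    x (@Ordinal 6 5 isT) = 3%:R] by split; rewrite xE.
have [u uE] : exists u, u = x (@Ordinal 6 0 isT) ^+ 2 by eexists.
have psum_u k : (psum k).@[x] = u ^+ k + 3 + 4 ^+ k + 9 ^+ k.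
  rewrite psumE big6 /= x1 x2 x3 x4 x5 -mul2n uE !exprM expr1n.
  have -> : 2%:R ^+ 2 = 4 :> K by ring.
  have -> : 3%:R ^+ 2 = 9 :> K by ring.
  by rewrite expr1n; ring.
have aE : sqrt1.@[x] = - 2^-1 * (u + 16).
  by rewrite sqrt1E psum_u; field.
have bE : sqrt2.@[x] = - 8^-1 * (u ^+ 2 - 32 * u - 56).
  by rewrite sqrt2E aE !psum_u; field.
have cE : sqrt3.@[x] = - 16^-1 * (u ^+ 3 - 16 * u ^+ 2 + 56 * u + 288).
  by rewrite sqrt3E aE bE !psum_u; field.
have dE : slope.@[x] = 64^-1 * (- 5 * u ^+ 4 + 64 * u ^+ 3 - 112 * u ^+ 2
    + (1 * 1000 + 152) * u - (13 *
    1000 + 824)).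
  by rewrite slopeE sqrt4E aE bE cE !psum_u; field.
have eE : \prod_i x i = 6 * x (@Ordinal 6 0 isT).
  by rewrite big6 /= x1 x2 x3 x4 x5; ring.
(* Squaring the equation of the sextic eliminates [s] and leaves a relation in u alone. *)
have c_sqr : sqrt3.@[x] ^+ 2 = 36 * u.
  by rewrite (sextic_root Fx) eE exprMn sqrrN s1 uE; ring.
(* A nonzero integer is no combination of two vanishing quantities; [a] and [b] are the Bezout
   cofactors. *)
have contra p q a b (m : nat) :
    p = 0 :> K -> q = 0 -> m != 0%N -> m%:R = a * p + b * q -> False.
  by move=> -> ->; rewrite !mulr0 addr0 => + /eqP; rewrite pnatr_eq0 => /negPf ->.
rewrite genericE !mulf_neq0 //.
- rewrite eE mulf_neq0 ?pnatr_eq0 //; apply/eqP => x00.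
  have : sqrt3.@[x] = 0 by rewrite (sextic_root Fx) eE x00 !mulr0.
  have u0 : u = 0 by rewrite uE x00 expr0n.
  move=> c0; have /eqP : (288 : K) = 0; last by rewrite pnatr_eq0.
  by transitivity (- 16 * sqrt3.@[x]); [rewrite cE u0; field | rewrite c0 mulr0].
- apply/eqP => slope0; apply: (@contra
    (- 5 * u ^+ 4 + 64 * u ^+ 3 - 112 * u ^+ 2
    + (1 * 1000 + 152) * u - (13 *
     1000 + 824))
    (u ^+ 6 - 32 * u ^+ 5 + 368 * u ^+ 4 - (1 * 1000 + 216) * u ^+ 3 - (6 *
     1000 + 80) * u ^+ 2 + (23 * 1000 + 40) * u + (82 * 1000 + 944))
    ((6 * 1000 + 407) * u ^+ 5 - (169 * 1000 + 278) * u ^+ 4 + ((1 * 1000 +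
     335) * 1000 + 152) * u ^+ 3 + (893 * 1000 + 568) * u ^+ 2 - ((38 * 1000 +
     666) * 1000 + 432) * u - ((112 * 1000 + 840) * 1000 + 64))
    ((32 * 1000 + 35) * u ^+ 3 - (231 * 1000 + 318) * u ^+ 2 - (963 * 1000 +
     920) * u - ((14 * 1000 + 87) * 1000 + 744))
    (2 ^ 20 * 3 ^ 3 * 5 ^ 2 * 7 * 79)%N); [ | | by rewrite !muln_eq0 | ring].
    by transitivity (64 * slope.@[x]); [rewrite dE; field | rewrite slope0 mulr0].
  transitivity (256 * (sqrt3.@[x] ^+ 2 - 36 * u)); first by rewrite cE; field.
  by rewrite c_sqr subrr mulr0.
- apply/prodf_neq0 => j _; apply/eqP => T0.
  have cv v : x j ^+ 2 = v ->
      sqrt3.@[x] = - (v ^+ 3 + sqrt1.@[x] * v ^+ 2 + sqrt2.@[x] * v).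
    by move: T0; rewrite /cubic => + <- => /eqP; rewrite addrC addr_eq0 => /eqP.
  have : [\/ x j ^+ 2 = u, x j ^+ 2 = 1, x j ^+ 2 = 4 | x j ^+ 2 = 9].
    case: (eqVneq j ord0) => [->|j0].
      by apply: Or41; rewrite uE; congr (x _ ^+ 2); apply: val_inj.
    rewrite xE //; case: j j0 {T0 cv} => -[|[|[|[|[|[|//]]]]]] lt_j //= _.
    - by apply: Or42; ring.
    - by apply: Or42; ring.
    - by apply: Or42; ring.
    - by apply: Or43; ring.
    - by apply: Or44; ring.
  (* In each case, with v = x_j^2, [p] is 16 T(v), and [q] is a multiple of (T(v) - [sqrt3])^2 - 36
     u, which vanishes by [c_sqr] since T(v) = 0. *)
  case=> /cv {T0}cv.
  + apply: (@contra
      (5 * u ^+ 3 - 48 * u ^+ 2 + 56 * u - 288)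
      (9 * u ^+ 6 - 192 * u ^+ 5 + (1 * 1000 + 360) * u ^+ 4 - (3 * 1000 +
       584) * u ^+ 3 + (3 * 1000 + 136) * u ^+ 2 - (2 * 1000 + 304) * u)
      ((286 * 1000 + 785) * u ^+ 5 - ((2 * 1000 + 691) * 1000 + 132) * u ^+ 4
       - ((3 * 1000 + 539) * 1000 + 488) * u ^+ 3 + ((73 * 1000 + 990) * 1000
       + 16) * u ^+ 2 - ((95 * 1000 + 455) * 1000 + 168) * u - ((411 * 1000 +
       955) * 1000 + 200))
      (- (159 * 1000 + 325) * u ^+ 2 - (374 * 1000 + 340) * u + ((1 * 1000 +
       919) * 1000 + 96))
      (2 ^ 17 * 3 ^ 5 * 5 ^ 2 * 149)%N); [ | | by rewrite !muln_eq0 | ring].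
      transitivity (16 *
        (sqrt3.@[x] + (u ^+ 3 + sqrt1.@[x] * u ^+ 2 + sqrt2.@[x] * u))).
        by rewrite aE bE cE; field.
      by rewrite cv addNr mulr0.
    transitivity (64 *
      ((u ^+ 3 + sqrt1.@[x] * u ^+ 2 + sqrt2.@[x] * u) ^+ 2 - 36 * u)).
      by rewrite aE bE; field.
    by rewrite -sqrrN -cv c_sqr subrr mulr0.
  + apply: (@contra
      (- u ^+ 3 + 14 * u ^+ 2 - 288)
      (u ^+ 4 - 56 * u ^+ 3 + 784 * u ^+ 2 - (2 * 1000 + 304) * u)
      (- 3 * u ^+ 3 + 154 * u ^+ 2 - (1 * 1000 + 568) * u - (3 * 1000 + 200))
      (- 3 * u ^+ 2 + 28 * u + 196)
      (2 ^ 12 * 3 ^ 2 * 5 ^ 2)%N); [ | | by rewrite !muln_eq0 | ring].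
      transitivity (16 *
        (sqrt3.@[x] + (1 ^+ 3 + sqrt1.@[x] * 1 ^+ 2 + sqrt2.@[x] * 1))).
        by rewrite aE bE cE; field.
      by rewrite cv addNr mulr0.
    transitivity (64 *
      ((1 ^+ 3 + sqrt1.@[x] * 1 ^+ 2 + sqrt2.@[x] * 1) ^+ 2 - 36 * u)).
      by rewrite aE bE; field.
    by rewrite -sqrrN -cv c_sqr subrr mulr0.
  + apply: (@contra
      (- u ^+ 3 + 8 * u ^+ 2 + 72 * u - 864)
      (u ^+ 4 - 32 * u ^+ 3 + 400 * u ^+ 2 - (2 * 1000 + 448) * u + (5 * 1000
       + 184))
      (7 * u ^+ 3 - 196 * u ^+ 2 + (1 * 1000 + 760) * u - (6 * 1000 + 512))
      (7 * u ^+ 2 - 28 * u - 872)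
      (2 ^ 13 * 3 ^ 3 * 5)%N); [ | | by rewrite !muln_eq0 | ring].
      transitivity (16 *
        (sqrt3.@[x] + (4 ^+ 3 + sqrt1.@[x] * 4 ^+ 2 + sqrt2.@[x] * 4))).
        by rewrite aE bE cE; field.
      by rewrite cv addNr mulr0.
    transitivity (4 *
      ((4 ^+ 3 + sqrt1.@[x] * 4 ^+ 2 + sqrt2.@[x] * 4) ^+ 2 - 36 * u)).
      by rewrite aE bE; field.
    by rewrite -sqrrN -cv c_sqr subrr mulr0.
  + apply: (@contra
      (- u ^+ 3 - 2 * u ^+ 2 - 128 * u + (2 * 1000 + 16))
      (9 * u ^+ 4 + 72 * u ^+ 3 - (2 * 1000 + 160) * u ^+ 2 - (9 * 1000 + 472)
       * u + (147 * 1000 + 456))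
      (- (209 * 1000 + 961) * u ^+ 3 - ((3 * 1000 + 558) * 1000 + 402) * u ^+
       2 + ((18 * 1000 + 658) * 1000 + 80) * u + ((388 * 1000 + 840) * 1000 +
       576))
      (- (23 * 1000 + 329) * u ^+ 2 - (255 * 1000 + 404) * u - ((5 * 1000 +
       259) * 1000 + 476))
      (2 ^ 12 * 3 ^ 3 * 5 * (15 * 1000 + 121))%N); [ | | by rewrite !muln_eq0 | ring].
      transitivity (16 *
        (sqrt3.@[x] + (9 ^+ 3 + sqrt1.@[x] * 9 ^+ 2 + sqrt2.@[x] * 9))).
        by rewrite aE bE cE; field.
      by rewrite cv addNr mulr0.
    transitivity (64/9 *
      ((9 ^+ 3 + sqrt1.@[x] * 9 ^+ 2 + sqrt2.@[x] * 9) ^+ 2 - 36 * u)).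
      by rewrite aE bE; field.
    by rewrite -sqrrN -cv c_sqr subrr mulr0.
Qed.

(** * Density of the generic locus in the sextic *)

Section Density.
Variables (s : K) (x : 'I_6 -> K).

(* The first coordinate is free, the others move along the line from x to the
   witness. *)
Let coord (i : 'I_6) : {poly K} :=
  (x i)%:P + ((nth 0 witness i)%:R - x i) *: 'X.

Let family : {mpoly K[6]} -> {poly {poly K}} :=
  mmap (polyC \o polyC) (fun i => if i == ord0 then 'X else (coord i)%:P).

Let point a b (i : 'I_6) := if i == ord0 then b else (coord i).[a].

Lemma familyE p a b :
  (map_poly (horner_eval a) (family p)).[b] = p.@[point a b].
Proof.
rewrite mevalE /family /mmap rmorph_sum horner_sum; apply: eq_bigr => m _ /=.
rewrite rmorphM hornerM /= map_polyC hornerC /= [horner_eval a _]hornerC; congr (_ * _).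
rewrite /mmap1 rmorph_prod horner_prod; apply: eq_bigr => i _.
rewrite rmorphXn horner_exp /point; case: (i == ord0).
  by rewrite /= map_polyX hornerX.
by rewrite /= map_polyC hornerC.
Qed.

Lemma family_psum k :
  family (psum k) = 'X ^+ (k.*2) + (\sum_(i | i != ord0) coord i ^+ (k.*2))%:P.
Proof.
rewrite /family /psum (raddf_sum (mmap _ _)) (bigD1 ord0) //= rmorphXn /= mmapX mmap1U.
rewrite eqxx; congr (_ + _); rewrite rmorph_sum; apply: eq_bigr => i /negPf i0.
by rewrite rmorphXn /= mmapX mmap1U i0 rmorphXn.
Qed.

Lemma family_prod :
  family (P111111 K) = 'X * (\prod_(i | i != ord0) coord i)%:P.
Proof.
rewrite /family /P111111 (bigD1 ord0) //= rmorphM /= mmapX mmap1U eqxx.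
congr (_ * _); rewrite !(rmorph_prod (mmap _ _), rmorph_prod polyC).
apply: eq_bigr => i /negPf i0.
by rewrite /= mmapX mmap1U i0.
Qed.

Lemma family_sextic :
  3%:R * family (sextic s) =
  family (psum 1) ^+ 3 - 6%:R * (family (psum 1) * family (psum 2))
  + 8%:R * family (psum 3) - (48%:R * s)%:P%:P * family (P111111 K).
Proof.
have := congr1 family (sextic_psum s).
rewrite /family scaler_nat -[_ *+ 3]mulr_natl -mul_mpolyC.
rewrite (rmorphM (mmap _ _)) (rmorph_nat (mmap _ _)) => ->.
rewrite (rmorphB (mmap _ _)) (rmorphD (mmap _ _)) (rmorphB (mmap _ _)).
rewrite (rmorphXn (mmap _ _)) !(rmorphM (mmap _ _)) !(rmorph_nat (mmap _ _)).
by congr (_ - _ * _); exact: mmapC.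
Qed.

Lemma family_monic : family (sextic s) \is monic.
Proof.
(* Apart from the leading term, the degree in the first coordinate is at most 4; the Horner form
   gives the size bound. *)
have [A [B [C [D E]]]] : exists A B C D,
    3%:R * family (sextic s) =
    (((A%:P * 'X + 0%:P) * 'X + B%:P) * 'X + C%:P) * 'X + D%:P + 3%:R * 'X^6.
  rewrite family_sextic !family_psum family_prod -!mul2n /=.
  move: (\sum_(i | _) _) (\sum_(i | _) _) (\sum_(i | _) _) (\prod_(i | _) _).
  move=> c3 c2 c1 m.
  exists (- 3%:R * c1), (3%:R * c1 ^+ 2 - 6%:R * c2), (- (48%:R * s)%:P * m).
  exists (c1 ^+ 3 - 6%:R * c1 * c2 + 8%:R * c3).
  ring.
have natE k : (k%:R : {poly {poly K}}) = k%:R%:P by rewrite polyC_natr.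
have three_neq0 : (3%:R : {poly K}) != 0 by rewrite -polyC_natr polyC_eq0 pnatr_eq0.
have := congr1 lead_coef E; rewrite natE [_ * 'X^6]mul_polyC lead_coefDr; last first.
  rewrite size_scale // size_polyXn ltnS.
  do 4!apply: size_horner_step; rewrite size_polyC.
  by case: (A == 0).
rewrite lead_coefZ lead_coefXn lead_coefM lead_coefC => lead3.
by rewrite monicE; apply/eqP/(mulfI three_neq0).
Qed.

(** Parameter 0 of the family gives back [x], and parameter 1 gives the witness fibre, where
    [generic] has no zero on the sextic. *)
Lemma sextic_dense (G : {mpoly K[6]}) : s ^+ 2 = 1 ->
    (forall y, (sextic s).@[y] = 0 -> generic.@[y] != 0 -> G.@[y] = 0) ->
  (sextic s).@[x] = 0 -> G.@[x] = 0.
Proof.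
move=> s1 G0 Fx.
have pt0 : point 0 (x ord0) =1 x.
  rewrite /point /coord => i; case: eqP => [->//|_].
  by rewrite hornerD hornerC hornerZ hornerX mulr0 addr0.
rewrite -(meval_eq _ pt0) -familyE.
apply: (monic_family_dense (h := family generic) family_monic).
- move=> a b; rewrite !familyE => Fy.
  have [->|/(G0 _ Fy) ->] := eqVneq generic.@[point a b] 0; last by rewrite mul0r.
  by rewrite mulr0.
- exists 1 => b; rewrite !familyE; apply: witness_generic => // i /negPf i0.
  by rewrite /point i0 /coord hornerD hornerC hornerZ hornerX mulr1 addrC subrK.
- by rewrite familyE (meval_eq _ pt0).
Qed.

End Density.

(** * The dual variety of each sextic *)

Lemma dhomog_sextic s : sextic s \is 6.-homog.
Proof.
have homX k (i : 'I_6) : ('X_i ^+ k : {mpoly K[6]}) \is k.-homog.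
  by rewrite -[X in X.-homog]mul1n; apply: dhomogMn; rewrite dhomogX /= mdeg1.
rewrite /sextic rpredB ?rpredZ ?rpredD ?rpredN //.
- by apply: rpred_sum => i _.
- by do 2!apply: rpred_sum => ? _; apply: (@dhomogM _ _ _ 4 _ 2).
- rewrite mulr_natl rpredMn //; do 3!apply: rpred_sum => ? _.
  by apply: (@dhomogM _ _ _ 4 _ 2) => //; apply: (@dhomogM _ _ _ 2 _ 2).
- rewrite /P111111 big6 /=; have homX1 := homX 1%N.
  by do 5![apply: (@dhomogM _ _ _ 1); first exact: homX1]; exact: homX1.
Qed.

(** The dual equation pulled back along the Gauss map is a polynomial, so its vanishing extends from
    the generic locus by density. *)
Lemma sextic_dual_all s x : s ^+ 2 = 1 ->
  (sextic s).@[x] = 0 -> (sextic (- s)).@[sextic_grad s x] = 0.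
Proof.
move=> s1; pose G := sextic (- s) \mPo [tuple 16%:R^-1 *: (sextic s)^`M(i) | i < 6].
have GE y : G.@[y] = (sextic (- s)).@[sextic_grad s y].
  rewrite comp_mpoly_meval; apply: meval_eq => i.
  by rewrite tnth_mktuple mevalZ mderiv_sextic mulKf ?pnatr_eq0.
rewrite -GE; apply: sextic_dense => // y Fy gy; rewrite GE.
by have [e0 _ _] := generic_neq0 Fy gy; apply: sextic_dual.
Qed.

Lemma dual_sextic s : s ^+ 2 = 1 ->
  dual_variety (n := 5) (sextic s) = hypersurface (n := 5) (sextic (- s)).
Proof.
move=> s1; have homF := dhomog_sextic s; have homF' := dhomog_sextic (- s).
apply/seteqP; split=> [|eta].
  (* The target is closed, so only tangent hyperplanes at smooth points matter; their coordinates
     are proportional to the gradient. *)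
  apply: smallest_sub; first exact: zariski_closed_hypersurface homF'.
  move=> xi /= [p [Fp [i F'p]] xip].
  have [v v0 pv] := line_vline p; have [a a0 xia] := line_vline xi.
  move/(vanishes_atE homF pv): Fp => Fv.
  pose g : 'rV[K]_6 := \row_j sextic_grad s (v 0) j.
  have gi0 : g 0 i != 0.
    apply/eqP; rewrite mxE => gi; apply: F'p.
    by apply/(vanishes_atE (dhomog_mderiv i homF) pv); rewrite mderiv_sextic gi mulr0.
  have aE := same_kernel_proportional gi0 _.
  apply/(vanishes_atE homF' xia).
  rewrite (meval_eq (v2 := fun j => a 0 i / g 0 i * sextic_grad s (v 0) j)).
    by rewrite (dhomog_meval _ _ homF') sextic_dual_all ?mulr0.
  move=> j; rewrite (aE a) ?mxE // => w w0; have [q qw] := vline_proj w0.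
  rewrite -(hyperplaneE xia qw) xip (tangent_spaceE homF pv qw).
  have -> : \sum_k ((sextic s)^`M(k)).@[v 0] * w 0 k = 16%:R * \sum_k g 0 k * w 0 k.
    by rewrite mulr_sumr; apply: eq_bigr => k _; rewrite mderiv_sextic mxE mulrA.
  by split=> [/eqP|->]; rewrite ?mulr0 // mulf_eq0 pnatr_eq0 => /eqP.
have [v v0 etav] := line_vline eta; move=> /(vanishes_atE homF' etav) Fv.
(* By density it suffices that the form [G] vanishes at generic points [y]; such a point is the
   tangent hyperplane at its own Gauss image [p]. *)
move=> Z [[I homI ->] imZ] G IG; have [d homG] := homI _ IG.
apply/(vanishes_atE homG etav).
have s1' : (- s) ^+ 2 = 1 by rewrite sqrrN.
apply: (sextic_dense s1' _ Fv) => y Fy gy.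
have [e0 slope0 grad0] := generic_neq0 Fy gy.
pose row (f : 'I_6 -> K) : 'rV[K]_6 := \row_i f i.
have rowE (H : {mpoly K[6]}) f : H.@[row f 0] = H.@[f].
  by apply: meval_eq => i; rewrite mxE.
have row_neq0 f : f ord0 != 0 -> row f != 0.
  by apply: contraNneq => /rowP/(_ ord0); rewrite !mxE => ->.
have y0 i : y i != 0 by apply: prod_neq0 e0.
have [xi xiy] := vline_proj (row_neq0 _ (y0 ord0)).
have [p px] := vline_proj (row_neq0 _ (grad0 ord0)).
have bidual i : ((sextic s)^`M(i)).@[row (sextic_grad (- s) y) 0] =
    16%:R * (- slope.@[y] ^+ 3) * y i.
  by rewrite rowE mderiv_sextic -{1}[s]opprK sextic_bidual // mulrA.
(* This nonzero factor makes [p] a smooth point and identifies its tangent space with the hyperplane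
   [xi]. *)
have c0 : 16%:R * (- slope.@[y] ^+ 3) != 0.
  by rewrite mulf_neq0 ?pnatr_eq0 // oppr_eq0 expf_neq0.
rewrite -rowE; apply/(vanishes_atE homG xiy); apply: imZ IG => /=.
exists p; first split.
- apply/(vanishes_atE homF px); rewrite rowE.
  by have := sextic_dual_all s1' Fy; rewrite opprK.
- exists ord0 => /(vanishes_atE (dhomog_mderiv _ homF) px)/eqP.
  by rewrite bidual mulf_eq0 (negPf c0) (negPf (y0 _)).
suff pE q : hyperplane xi q <-> tangent_space (sextic s) p q.
  by apply/seteqP; split=> q /pE.
have [w w0 qw] := line_vline q.
rewrite (hyperplaneE xiy qw) (tangent_spaceE homF px qw).
have -> : \sum_k ((sextic s)^`M(k)).@[row (sextic_grad (- s) y) 0] * w 0 k =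
    16%:R * (- slope.@[y] ^+ 3) * \sum_k row y 0 k * w 0 k.
  by rewrite mulr_sumr; apply: eq_bigr => k _; rewrite bidual mxE mulrA.
by split=> [->|/eqP]; rewrite ?mulr0 // mulf_eq0 (negPf c0) => /eqP.
Qed.

End Invariants.

Theorem proposition6p7 (R : realType) :
  dual_variety (n := 5) (F6 R[i]) = hypersurface (n := 5) (F6dual R[i]) /\
  dual_variety (n := 5) (F6dual R[i]) = hypersurface (n := 5) (F6 R[i]).
Proof.
rewrite (F6_sextic R[i]) (F6dual_sextic R[i]); split.
  by apply: dual_sextic; rewrite expr1n.
by rewrite dual_sextic ?opprK // sqrrN expr1n.
Qed.
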